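(* Let $A=\{a_1,\dots,a_K\}$ be a finite set of items, let $\mathcal{F}$ be an antimonotonic family of itemsets over $A$ with dependency graph $G$, and let $C\subseteq A$ be such that there exists $x\in A\setminus C$ with $\mathrm{fr}(x,C)\notin\mathcal{F}$. Then there exist frequencies $\theta$ for $\mathcal{F}$ such that $C$ is not $\theta$-safe.
   Context: An itemset is a subset $U\subseteq A$; its indicator $S_U:\{0,1\}^K\to\{0,1\}$ is $S_U(z)=1$ iff $z_i=1$ for all $a_i\in U$. A family $\mathcal{F}$ of itemsets is antimonotonic if every subset of a member of $\mathcal{F}$ belongs to $\mathcal{F}$. A distribution $p$ on $\{0,1\}^K$ satisfies a vector $\theta=(\theta_U)_{U\in\mathcal{F}}$ if $E_p[S_U]=\theta_U$ for all $U\in\mathcal{F}$; ''frequencies for $\mathcal{F}$'' means a vector $\theta$ satisfied by at least one distribution on $\{0,1\}^K$. For $C\subseteq A$ write $\pi_C\mathcal{F}=\{U\in\mathcal{F}:U\subseteq C\}$ and $\pi_C\theta=(\theta_U)_{U\in\pi_C\mathcal{F}}$; for a distribution $p$ on $\{0,1\}^K$, $\pi_C p$ is its marginal on the coordinates indexed by $C$, and $p$ is an extension of a distribution $q$ on $\{0,1\}^C$ if $\pi_C p=q$. A distribution $q$ on $\{0,1\}^C$ satisfies $\pi_C\theta$ if $E_q[S_U]=\theta_U$ for all $U\in\pi_C\mathcal{F}$. The set $C$ is $\theta$-safe if every distribution $q$ on $\{0,1\}^C$ satisfying $\pi_C\theta$ has an extension $p$ on $\{0,1\}^K$ satisfying $\theta$.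 The dependency graph $G$ has vertex set $A$ and an undirected edge $\{a_i,a_j\}$ ($i\ne j$) iff $\{a_i,a_j\}\in\mathcal{F}$. For $x\notin C$, a path from $x$ to $C$ is a path $x=v_1,\dots,v_L$ in $G$ with $v_L\in C$ and $v_1,\dots,v_{L-1}\notin C$; the frontier $\mathrm{fr}(x,C)$ is the set of last vertices of all paths from $x$ to $C$.
   Formalization: The family F is assumed non-empty (so it contains the empty itemset); for empty F and C ≠ A the frontier is empty and not in F, yet there are no constraints and C is safe, so the claim fails. *)

(* Defs.v *)
From HB Require Import structures.
From mathcomp Require Import all_boot all_order all_algebra.
From mathcomp Require Import boolp reals.

Set Implicit Arguments.
Unset Strict Implicit.
Unset Printing Implicit Defensive.

Import Order.TTheory GRing.Theory Num.Theory.
Local Open Scope ring_scope.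

Record distr (R : realType) (T : finType) := Distr {
  dval :> T -> R;
  distr_ge0 : forall t, 0 <= dval t;
  distr_sum1 : \sum_t dval t = 1
}.

Definition expectation (R : realType) (T : finType) (p : distr R T)
    (f : T -> R) : R :=
  \sum_t p t * f t.

Definition cube (I : finType) := {ffun I -> bool}.

Definition indic (I : finType) (U : {set I}) (z : cube I) : bool :=
  [forall i in U, z i].

(* The coordinates of {0,1}^C. *)
Definition coords (A : finType) (C : {set A}) : finType := {a : A | a \in C}.

(* U, for U \subset C, seen as a set of coordinates of {0,1}^C. *)
Definition itemset_in (A : finType) (C U : {set A}) : {set coords C} :=
  [set i | val i \in U].

Definition antimonotonic (A : finType) (F : {set {set A}}) : Prop :=
  forall U V : {set A}, U \in F -> V \subset U -> V \in F.

Definition proj_family (A : finType) (C : {set A}) (F : {set {set A}}) :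
    {set {set A}} :=
  [set U in F | U \subset C].

(* A vector indexed by F is represented by a function theta on all itemsets of
   which only the values on F are ever used; the projection of the vector to
   the subsets of C is then the same theta used with proj_family C F. *)
Definition satisfies (R : realType) (A : finType) (F : {set {set A}})
    (theta : {set A} -> R) (p : distr R (cube A)) : Prop :=
  forall U, U \in F -> expectation p (fun z => (indic U z)%:R) = theta U.

Definition satisfies_proj (R : realType) (A : finType) (C : {set A})
    (F : {set {set A}}) (theta : {set A} -> R)
    (q : distr R (cube (coords C))) : Prop :=
  forall U, U \in proj_family C F ->
    expectation q (fun w => (indic (itemset_in C U) w)%:R) = theta U.

Definition frequencies (R : realType) (A : finType) (F : {set {set A}})
    (theta : {set A} -> R) : Prop :=
  exists p : distr R (cube A), satisfies F theta p.

Definition restrict (A : finType) (C : {set A}) (z : cube A) :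
    cube (coords C) :=
  [ffun i => z (val i)].

Section Marginal.
Variables (R : realType) (A : finType) (C : {set A}) (p : distr R (cube A)).

Definition marginal_fun (w : cube (coords C)) : R :=
  \sum_(z | restrict C z == w) p z.

Lemma marginal_ge0 w : 0 <= marginal_fun w.
Proof. by apply: sumr_ge0 => z _; apply: distr_ge0. Qed.

Lemma marginal_sum1 : \sum_w marginal_fun w = 1.
Proof. by rewrite -(distr_sum1 p) (partition_big (restrict C) xpredT). Qed.

Definition marginal : distr R (cube (coords C)) :=
  Distr marginal_ge0 marginal_sum1.

End Marginal.

Definition extension (R : realType) (A : finType) (C : {set A})
    (p : distr R (cube A)) (q : distr R (cube (coords C))) : Prop :=
  marginal C p =1 q.

Definition safe (R : realType) (A : finType) (F : {set {set A}})
    (theta : {set A} -> R) (C : {set A}) : Prop :=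
  forall q : distr R (cube (coords C)), satisfies_proj F theta q ->
    exists p : distr R (cube A), extension p q /\ satisfies F theta p.

Definition dep_graph (A : finType) (F : {set {set A}}) : rel A :=
  [rel a b | (a != b) && ([set a; b] \in F)].

(* The vertices of the path are v_1 = x and v_2, ..., v_L = s, so that
   belast x s lists v_1, ..., v_(L-1). *)
Definition path_to (A : finType) (F : {set {set A}}) (x : A) (C : {set A})
    (s : seq A) : bool :=
  [&& path (dep_graph F) x s, uniq (x :: s), last x s \in C
    & all (fun v => v \notin C) (belast x s)].

Definition frontier (A : finType) (F : {set {set A}}) (x : A) (C : {set A}) :
    {set A} :=
  [set b | `[< exists2 s : seq A, path_to F x C s & last x s = b >]].

(* Main.v *)
Require Import Defs.
From mathcomp Require Import all_boot all_order all_algebra.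
From mathcomp Require Import boolp reals.

(** Let [W] be the frontier of [x].  Draw an even subset [T] of [W] uniformly,
    put [1] on [T], [0] on [C] minus [T], and let every item outside [C] be the
    indicator of [T] being empty; let [theta] be the frequencies of this
    distribution.  An odd [T] instead of an even one gives the same frequencies
    for every itemset in [C] but [W], hence a distribution [q] on [{0,1}^C] that
    satisfies the projection of [theta].  On the other hand, in a distribution
    that satisfies [theta], the edges on a path from [x] to [w] in [W] force
    [z w = 0] whenever [z x = 1].  As [z x = 1] has positive probability, so has
    the event that [z] vanishes on [W], to which [q] gives probability [0]. *)

Set Implicit Arguments.
Unset Strict Implicit.
Unset Printing Implicit Defensive.

Import Order.TTheory GRing.Theory Num.Theory.
Local Open Scope ring_scope.

(** * Images of uniform distributions *)

Section Uniform.
Variables (R : realType) (J T : finType) (E : {set J}) (f : J -> T).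

(** The push-forward along [f] of the uniform distribution on [E], so that expectations of
    indicators become counts in [E]. *)
Definition unif_fun (t : T) : R := \sum_(j in E | f j == t) (#|E|%:R)^-1.

Lemma unif_ge0 t : 0 <= unif_fun t.
Proof. by apply: sumr_ge0 => j _; rewrite invr_ge0. Qed.

Lemma unif_sum1 : E != set0 -> \sum_t unif_fun t = 1.
Proof.
move=> E0; rewrite -(partition_big f xpredT) //= sumr_const -[LHS]mulr_natl.
by rewrite divff // pnatr_eq0 cards_eq0.
Qed.

Definition unif_image (E0 : E != set0) : distr R T :=
  Distr unif_ge0 (unif_sum1 E0).

Lemma expectation_unif_image (E0 : E != set0) (g : pred T) :
  expectation (unif_image E0) (fun t => (g t)%:R) =
  #|[set j in E | g (f j)]|%:R / #|E|%:R.
Proof.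
rewrite /expectation /= -sum1_card natr_sum mulr_suml.
under [LHS]eq_bigr => t _ do rewrite mulr_suml.
transitivity (\sum_(j in E) (#|E|%:R)^-1 * (g (f j))%:R : R).
  rewrite (partition_big f xpredT) //=; apply: eq_bigr => t _.
  by apply: eq_bigr => j /andP[_ /eqP->].
rewrite [LHS](bigID (fun j => g (f j))) /= [X in _ + X]big1 => [|j]; last first.
  by case/andP=> _ /negPf->; rewrite mulr0.
rewrite addr0; apply: eq_big => [j|j /andP[_ ->]]; first by rewrite inE.
by rewrite mulr1 mul1r.
Qed.

Lemma unif_image_support (E0 : E != set0) t :
  unif_image E0 t != 0 -> exists2 j, j \in E & f j = t.
Proof.
apply: contra_neqP => noj; rewrite /= /unif_fun big_pred0 // => j.
by apply/negP => /andP[jE /eqP jt]; apply: noj; exists j.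
Qed.

End Uniform.

(** * Even and odd subsets of a set *)

Section Parity.
Variable A : finType.
Implicit Types (U W T : {set A}) (b : bool).

Definition parity_subsets W b : {set {set A}} :=
  [set T : {set A} | (T \subset W) && (odd #|T| == b)].

(** The symmetric difference of [T] with the singleton of [w]. *)
Definition toggle (w : A) T := if w \in T then T :\ w else w |: T.

Lemma toggleK w : involutive (toggle w).
Proof.
move=> T; rewrite /toggle; case: (boolP (w \in T)) => wT.
  by rewrite setD11 setD1K.
by rewrite setU11 setU1K.
Qed.

Lemma odd_toggle w T : odd #|toggle w T| = ~~ odd #|T|.
Proof.
rewrite /toggle; case: (boolP (w \in T)) => wT.
  by rewrite (cardsD1 w T) wT /= negbK.
by rewrite cardsU1 wT.
Qed.

Lemma toggle_subset w W T : w \in W -> (toggle w T \subset W) = (T \subset W).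
Proof.
move=> wW; rewrite /toggle; case: (boolP (w \in T)) => wT.
  by rewrite -{2}(setD1K wT) subUset sub1set wW.
by rewrite subUset sub1set wW.
Qed.

Lemma subset_toggle w U T : w \notin U ->
  (U \subset toggle w T) = (U \subset T).
Proof.
move=> wU; rewrite /toggle; case: (boolP (w \in T)) => wT.
  by rewrite subsetD1 wU andbT.
by rewrite -{2}(setU1K wT) subsetD1 wU andbT.
Qed.

(** Toggling an element of [W] outside [U] exchanges odd and even subsets and keeps [U] inside. For
    [U = W] the counts would differ, [W] being the only subset of itself that contains [U]. *)
Lemma card_parity_subsets U W : U \proper W ->
  #|[set T in parity_subsets W true | U \subset T]| =
  #|[set T in parity_subsets W false | U \subset T]|.
Proof.
case/properP => _ [w wW wU].
rewrite -(card_imset _ (inv_inj (toggleK w))); apply: eq_card => T.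
rewrite -{1}(toggleK w T) mem_imset; last exact: inv_inj (toggleK w).
by rewrite !inE toggle_subset // subset_toggle // odd_toggle; case: odd.
Qed.

Lemma parity_subsets_neq0 W b : W != set0 -> parity_subsets W b != set0.
Proof.
case/set0Pn => w wW; apply/set0Pn; exists (if b then [set w] else set0).
by case: b; rewrite inE ?sub1set ?sub0set ?wW ?cards1 ?cards0.
Qed.

End Parity.

(** * From frequencies to constraints on the support *)

Section Support.
Variables (R : realType) (T : finType) (p : distr R T).

Lemma expectation_eq0_support (f : T -> R) t : (forall u, 0 <= f u) ->
  expectation p f = 0 -> p t != 0 -> f t = 0.
Proof.
move=> f0 /eqP; rewrite psumr_eq0 => [/allP/(_ t)|u _]; last first.
  by rewrite mulr_ge0 // distr_ge0.
by rewrite mem_index_enum mulf_eq0 => /(_ isT) /orP[->|/eqP].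
Qed.

Lemma expectation_neq0_support (f : T -> R) :
  expectation p f != 0 -> exists2 t, p t != 0 & f t != 0.
Proof.
apply: contra_neqP => nt; apply: big1 => t _; apply/eqP; rewrite mulf_eq0.
by apply: contra_notT nt; rewrite negb_or => /andP[]; exists t.
Qed.

End Support.

Lemma indic_subset (A : finType) (U V : {set A}) (z : cube A) :
  V \subset U -> indic U z -> indic V z.
Proof.
move=> /subsetP sVU /forall_inP Uz.
by apply/forall_inP => a aV; apply/Uz/sVU.
Qed.

Lemma indic1 (A : finType) (a : A) (z : cube A) : indic [set a] z = z a.
Proof.
apply/forall_inP/idP => [|za i]; first by apply; rewrite inE.
by rewrite inE => /eqP->.
Qed.

Lemma indic2 (A : finType) (a b : A) (z : cube A) :
  indic [set a; b] z = z a && z b.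
Proof.
apply/forall_inP/andP => [h|[za zb] i].
  by split; apply: h; rewrite !inE eqxx ?orbT.
by rewrite !inE => /orP[] /eqP->.
Qed.

(** The indicator of [V] minus that of [U] is nonnegative and has expectation 0, so it vanishes on
    the support of [p]. *)
Lemma indic_eq_support (R : realType) (A : finType) (p : distr R (cube A))
    (U V : {set A}) (z : cube A) : V \subset U ->
  expectation p (fun z => (indic U z)%:R) =
    expectation p (fun z => (indic V z)%:R) ->
  p z != 0 -> indic V z -> indic U z.
Proof.
move=> sVU eqE pz Vz.
pose f z : R := (indic V z)%:R - (indic U z)%:R.
suff /eqP : f z = 0 by rewrite /f Vz; case: indic; rewrite // subr0 oner_eq0.
apply: expectation_eq0_support pz => [u|].
  rewrite /f subr_ge0 ler_nat; case: (boolP (indic U u)) => // Uu.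
  by rewrite (indic_subset sVU Uu).
rewrite /expectation; under eq_bigr do rewrite mulrBr.
by rewrite sumrB; move: eqE; rewrite /expectation => ->; rewrite subrr.
Qed.

Lemma marginal_support (R : realType) (A : finType) (C : {set A})
    (p : distr R (cube A)) (z : cube A) :
  p z != 0 -> marginal C p (restrict C z) != 0.
Proof.
move=> pz; rewrite /= /marginal_fun psumr_neq0 => [|u _]; last exact: distr_ge0.
by apply/hasP; exists z; rewrite ?mem_index_enum // eqxx /= lt_def pz distr_ge0.
Qed.

(** * The unsafe frequencies *)

Section Construction.
Variables (R : realType) (A : finType) (F : {set {set A}}) (C W : {set A}).
Implicit Types (U V T : {set A}) (u v w : A).
Hypotheses (F_anti : antimonotonic F) (sWC : W \subset C) (W0 : W != set0).
Hypothesis WF : W \notin F.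

Definition even_point (T : {set A}) : cube A :=
  [ffun a => if a \in C then a \in T else T == set0].

Definition odd_point (T : {set A}) : cube (coords C) := [ffun i => val i \in T].

Definition even_distr : distr R (cube A) :=
  unif_image R even_point (parity_subsets_neq0 false W0).

Definition odd_distr : distr R (cube (coords C)) :=
  unif_image R odd_point (parity_subsets_neq0 true W0).

Definition even_freq (U : {set A}) : R :=
  expectation even_distr (fun z => (indic U z)%:R).

Lemma indic_even_point U T : U \subset C ->
  indic U (even_point T) = (U \subset T).
Proof.
move=> /subsetP sUC; apply/forall_inP/subsetP => h a aU; move: (h a aU).
  by rewrite ffunE sUC.
by rewrite ffunE sUC.
Qed.

Lemma indic_odd_point U T : U \subset C ->
  indic (itemset_in C U) (odd_point T) = (U \subset T).
Proof.
move=> /subsetP sUC; apply/forall_inP/subsetP => [h a aU|h i].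
  by have := h (exist _ a (sUC a aU)); rewrite inE ffunE; apply.
by rewrite inE ffunE; apply: h.
Qed.

(** Both sides count the subsets of [W] of a given parity that contain [U]. As [W] is not in [F],
    antimonotonicity leaves only two cases: [U] is a proper subset of [W], or it is not inside
    [W]. *)
Lemma odd_distr_satisfies : satisfies_proj F even_freq odd_distr.
Proof.
move=> U; rewrite inE => /andP[UF sUC].
rewrite /even_freq !expectation_unif_image.
(* The normalizing constants agree: this is the toggling count for the empty [U]. *)
have -> : #|parity_subsets W true| = #|parity_subsets W false|.
  have := @card_parity_subsets A set0 W; rewrite proper0 => /(_ W0).
  by congr (_ = _); apply: eq_card => T; rewrite inE sub0set andbT.
congr (_%:R / _).
transitivity #|[set T in parity_subsets W true | U \subset T]|.
  by apply: eq_card => T; rewrite !inE indic_odd_point.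
transitivity #|[set T in parity_subsets W false | U \subset T]|; last first.
  by apply: eq_card => T; rewrite !inE indic_even_point.
have [sUW|nUW] := boolP (U \subset W).
  apply: card_parity_subsets; rewrite properE sUW /=.
  by apply: contra WF; apply: F_anti.
(* No subset of [W] contains [U], so both counts are 0. *)
rewrite !eq_card0 // => T; rewrite !inE; apply/negP => /andP[/andP[sTW _] sUT];
  by rewrite (subset_trans sUT sTW) in nUW.
Qed.

Lemma eq_even_freq U V :
  (forall T, T \subset W -> indic U (even_point T) = indic V (even_point T)) ->
  even_freq U = even_freq V.
Proof.
move=> eqUV; rewrite /even_freq !expectation_unif_image; congr (_%:R / _).
apply: eq_card => T; rewrite [LHS]inE [RHS]inE.
case: (boolP (T \in parity_subsets W false)) => //.
by rewrite inE => /andP[/eqUV->].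
Qed.

Lemma even_freq_outside u : u \notin C -> even_freq [set u] != 0.
Proof.
move=> uC; rewrite /even_freq expectation_unif_image.
rewrite mulf_neq0 ?invr_eq0 ?pnatr_eq0 ?cards_eq0 ?parity_subsets_neq0 //.
apply/set0Pn; exists set0.
by rewrite !inE sub0set cards0 /= indic1 ffunE (negPf uC) eqxx.
Qed.

Lemma even_freq_edge u v : u \notin C -> v \notin C ->
  even_freq [set u; v] = even_freq [set u].
Proof.
move=> uC vC; apply: eq_even_freq => T _.
by rewrite indic1 indic2 !ffunE (negPf uC) (negPf vC) andbb.
Qed.

(** The value at [u] is 1 only when [T] is empty, and then the value at [w] is 0. *)
Lemma even_freq_boundary u w : u \notin C -> w \in C ->
  even_freq [set u; w] = 0.
Proof.
move=> uC wC; rewrite /even_freq expectation_unif_image eq_card0 ?mul0r // => T.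
rewrite !inE indic2 !ffunE (negPf uC) wC; apply/negP => /and3P[_ /eqP->].
by rewrite inE.
Qed.

(** By induction on the path: an edge outside [C] has the frequency of its first endpoint, so it
    passes the value 1 on; the last edge enters [C] and has frequency 0. *)
Lemma path_support (p : distr R (cube A)) (z : cube A) (y : A) (s : seq A) :
  satisfies F even_freq p -> p z != 0 ->
  y \notin C -> path (dep_graph F) y s -> last y s \in C ->
  all (fun v => v \notin C) (belast y s) -> z y -> ~~ z (last y s).
Proof.
move=> pF pz; elim: s y => [|v s IH] y yC /=; first by rewrite (negPf yC).
case/andP=> /andP[_ yvF] vs lC /andP[_ sC] zy.
have yF : [set y] \in F by apply: F_anti yvF _; rewrite sub1set !inE eqxx.
have [vC|vC] := boolP (v \in C).
  (* Only the last vertex may lie in [C], so the path stops at [v]. *)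
  case: s sC {IH vs lC} => [_|? ?] /=; last by rewrite vC.
  apply/negP => zv.
  have /(expectation_eq0_support (t := z)) : expectation p
      (fun z => (indic [set y; v] z)%:R) = 0.
    by rewrite (pF _ yvF) even_freq_boundary.
  by move=> /(_ (fun _ => ler0n _ _) pz)/eqP; rewrite indic2 zy zv oner_eq0.
apply: IH => //.
have: indic [set y; v] z.
  apply: (@indic_eq_support _ _ p _ [set y]) pz _; rewrite ?indic1 //.
    by rewrite sub1set !inE eqxx.
  by rewrite (pF _ yvF) (pF _ yF) even_freq_edge.
by rewrite indic2 => /andP[].
Qed.

Lemma even_freq_not_safe x : x \notin C -> W \subset frontier F x C ->
  ~ safe F even_freq C.
Proof.
move=> xC /subsetP sWfr /(_ odd_distr odd_distr_satisfies) [p [pq pF]].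
have pathW w : w \in W -> exists2 s, path_to F x C s & last x s = w.
  by move/sWfr; rewrite inE => /asboolP.
(* Since [x] is outside [C], a path to a point of [W] has a first edge; this edge is in [F], hence
   so is its endpoint [x]. *)
have xF : [set x] \in F.
  case/set0Pn: W0 => w wW; have [[|v s]] := pathW w wW.
    by rewrite /path_to /= (negPf xC).
  case/and4P=> /= /andP[/andP[_ xvF] _] _ _ _ _.
  by apply: F_anti xvF _; rewrite sub1set !inE eqxx.
have := even_freq_outside xC; rewrite -(pF _ xF).
case/expectation_neq0_support => z pz; rewrite indic1.
case: (boolP (z x)) => [zx _|_]; last by rewrite eqxx.
(* The restriction of [z] to [C] is the point of an odd [T]. Such a [T] is nonempty, so [z] is 1 at
   some [w] in [W], against the path from [x] to [w]. *)
have := marginal_support C pz; rewrite pq => /unif_image_support[T].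
rewrite inE => /andP[/subsetP sTW /eqP oddT] eqT.
have [w wT] : exists w, w \in T.
  by apply/set0Pn; apply: contraTneq oddT => ->; rewrite cards0.
have [s /and4P[xs _ sC sNC] lw] := pathW w (sTW w wT).
have := path_support pF pz xC xs sC sNC zx; rewrite lw.
have wC : w \in C by apply: subsetP sWC _ (sTW w wT).
have := congr1 (fun f : cube (coords C) => f (exist _ w wC)) eqT.
by rewrite !ffunE /= wT => <-.
Qed.

End Construction.

Theorem theorem2 (R : realType) (K : nat) (F : {set {set 'I_K}})
    (C : {set 'I_K}) (F_neq0 : F != set0) (F_anti : antimonotonic F)
    (hC : exists2 x : 'I_K, x \notin C & frontier F x C \notin F) :
  exists theta : {set 'I_K} -> R, frequencies F theta /\ ~ safe F theta C.
Proof.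
case: hC => x xC frF.
have F0 : set0 \in F.
  by case/set0Pn: F_neq0 => U UF; apply: F_anti UF (sub0set U).
have sfrC : frontier F x C \subset C.
  by apply/subsetP => b; rewrite inE => /asboolP[s /and4P[_ _ ? _] <-].
(* The empty itemset is in [F] and the frontier is not. *)
have fr0 : frontier F x C != set0 by apply: contraNneq frF => ->.
exists (even_freq R C fr0); split; first by exists (even_distr R C fr0).
exact: (even_freq_not_safe F_anti sfrC frF xC (fintype.subxx _)).
Qed.
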